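(* Let $d\ge 2$, let $X_1,\dots,X_d$ be Polish spaces with Borel probability measures $\mu_1,\dots,\mu_d$ respectively, and let $E=X_1\times\dots\times X_d$. Let $c:E\to[0,\infty)$ be a continuous function which is bounded by a sum of integrable functions, i.e. there are functions $f_i\in L_1(\mu_i)$, $i=1,\dots,d$, such that $$c(x_1,\dots,x_d)\le f_1(x_1)+\dots+f_d(x_d)\quad\text{for all }(x_1,\dots,x_d)\in E.$$ Let $\mu\in\mathcal{M}(\mu_1,\dots,\mu_d)$ be a $c$-cyclically monotone transport plan. Then $\mu$ is optimal, i.e. $$\int c\,d\mu=\inf_{\mu'\in\mathcal{M}(\mu_1,\dots,\mu_d)}\int c\,d\mu'.$$
   Context: $\mathcal{M}(\mu_1,\dots,\mu_d)$ denotes the set of Borel probability measures $\mu$ on $E=X_1\times\dots\times X_d$ whose marginals are $\mu_1,\dots,\mu_d$, i.e. $p_i(\mu)=\mu_i$ (push-forward) for $i=1,\dots,d$, where $p_i:E\to X_i$ is the canonical projection. Its elements are called transport plans. A set $\Gamma\subseteq E$ is $c$-cyclically monotone if it satisfies either of the following two equivalent conditions: (i) for any $n\ge1$, any points $(x_1^{(1)},\dots,x_d^{(1)}),\dots,(x_1^{(n)},\dots,x_d^{(n)})\in\Gamma$ and any permutations $\sigma_2,\dots,\sigma_d$ of $\{1,\dots,n\}$, $$\sum_{i=1}^n c\bigl(x_1^{(i)},\dots,x_d^{(i)}\bigr)\le\sum_{i=1}^n c\bigl(x_1^{(i)},x_2^{(\sigma_2(i))},\dots,x_d^{(\sigma_d(i))}\bigr);$$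 (ii) for any finite measure $\alpha$ concentrated on finitely many points of $\Gamma$ and any measure $\alpha'$ on $E$ with the same marginals as $\alpha$, $\int c\,d\alpha\le\int c\,d\alpha'$. A transport plan is $c$-cyclically monotone if it is concentrated on a $c$-cyclically monotone set $\Gamma\subseteq E$. *)

(* Defs.v *)
From HB Require Import structures.
From mathcomp Require Import all_boot all_order all_algebra all_fingroup.
From mathcomp Require Import all_classical all_reals all_analysis.

Set Implicit Arguments.
Unset Strict Implicit.
Unset Printing Implicit Defensive.

Import Order.TTheory GRing.Theory Num.Theory.
Import numFieldNormedType.Exports.

Local Open Scope classical_set_scope.
Local Open Scope ring_scope.

Definition metrizes (R : realType) (T : topologicalType) (dist : T -> T -> R) :=
  forall (x : T) (A : set T),
    nbhs x A <-> exists2 e : R, 0 < e & [set y | dist x y < e] `<=` A.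

Definition is_distance (R : realType) (T : Type) (dist : T -> T -> R) :=
  [/\ forall x, dist x x = 0,
      forall x y, dist x y = 0 -> x = y,
      forall x y, dist x y = dist y x
    & forall y x z, dist x z <= dist x y + dist y z].

(* Convergence of [u] is taken in the topology of [T]; this is convergence for
   [dist] as soon as [dist] metrizes [T]. *)
Definition complete_distance (R : realType) (T : topologicalType)
    (dist : T -> T -> R) :=
  forall u : nat -> T,
    (forall e : R, 0 < e -> \forall m & n \near \oo, dist (u m) (u n) < e) ->
    exists l : T, u @ \oo --> l.

Definition separable (T : topologicalType) :=
  exists2 D : set T, countable D & dense D.

Definition polish (R : realType) (T : topologicalType) :=
  separable T /\
  exists dist : T -> T -> R,
    [/\ is_distance dist, metrizes dist & complete_distance dist].

(* [T] with its Borel sigma-algebra. *)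
Notation borel T := (g_sigma_algebraType (@open T)).

Section transport.
Context {R : realType} {d : nat} {X : 'I_d -> ptopologicalType}.

Local Notation E := (prod_topology X).

Definition transport_plans (mu_ : forall i, probability (borel (X i)) R) :
    set (probability (borel E) R) :=
  [set mu | forall (i : 'I_d) (A : set (borel (X i))),
    measurable A ->
    pushforward mu (proj i : borel E -> borel (X i)) A = mu_ i A].

(* Only the coordinates after the first are permuted: the family [sigma] is the
   identity on the coordinate of value 0. *)
Definition cyclically_monotone_set (c : E -> R) (Gamma : set E) :=
  forall (n : nat) (x : 'I_n -> E) (sigma : 'I_d -> 'S_n),
    (1 <= n)%N ->
    (forall k, Gamma (x k)) ->
    (forall i : 'I_d, val i = 0%N -> sigma i = 1%g) ->
    \sum_(k < n) c (x k) <= \sum_(k < n) c (fun i => x (sigma i k) i).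

(* [Gamma] need not be Borel, so [mu] being concentrated on it means that its
   complement is contained in a Borel null set. *)
Definition cyclically_monotone_plan (c : E -> R)
    (mu : probability (borel E) R) :=
  exists2 Gamma : set E,
    cyclically_monotone_set c Gamma & mu.-negligible (~` Gamma).

Definition transport_cost (c : E -> R) (mu : probability (borel E) R) : \bar R :=
  (\int[mu]_x (c x)%:E)%E.

Definition optimal (c : E -> R) (mu_ : forall i, probability (borel (X i)) R)
    (mu : probability (borel E) R) :=
  transport_cost c mu =
  ereal_inf [set transport_cost c mu' | mu' in transport_plans mu_].

End transport.

(* Main.v *)
Require Import Defs.
From mathcomp Require Import all_boot all_order all_algebra all_fingroup.
From mathcomp Require Import all_classical all_reals all_analysis.
From mathcomp Require Import measurable_realfun lra.

Set Implicit Arguments.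
Unset Strict Implicit.
Unset Printing Implicit Defensive.

Import Order.TTheory GRing.Theory Num.Theory.
Import numFieldNormedType.Exports.

Local Open Scope classical_set_scope.
Local Open Scope ring_scope.

(** Let [mu] be the cyclically monotone plan and [nu] any other plan.  The proof
    compares the two costs by discretizing, in a way that uses neither dual
    potentials nor compactness.

    Suppose first that each [X i] is cut into finitely many measurable pieces,
    so that the product is cut into finitely many cells, and that the cost is
    bounded above by a function [h] that is constant on every cell.  In each
    cell [a] pick a point [x a] of the cyclically monotone set whose cost is at
    least the [mu]-average of the cost over the cell.  Then the [mu]-cost is at
    most [\sum_a mu a * c (x a)].  For a large [n], take about [n * mu a] copies
    of each [x a].  Because [mu] and [nu] have the same marginals, the
    coordinates of these points can be permuted, one coordinate at a time, so
    that about [n * nu a] of the new points fall in each cell [a].  Cyclic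
    monotonicity says that the permutation does not decrease the cost, and the
    new cost is at most [n * \sum_a nu a * h a] up to an error that does not
    grow with [n].  Dividing by [n], the [mu]-cost is at most the integral of
    [h] against [nu] ([cyclically_monotone_step]).

    It remains to bring such an [h] close to the cost in [L_1(nu)].  By second
    countability, finitely many open boxes on which [c] varies by less than a
    small [e] carry almost all of the mass of [nu]; the sides of the boxes
    define the pieces of each [X i].  On a cell inside one of the boxes, [h] is
    a value of [c] plus [e].  On the other cells the cost may be unbounded.  To
    deal with them, write [c <= M + G] where [M] is a constant and [G] is the
    sum of the excesses of the [|f i|] over large thresholds.  As [G] is a sum
    of functions of one coordinate, [c - G] is still cyclically monotone, so
    that the first part applies to it, with [h = M] on the other cells.  Both
    [M] times the [nu]-mass of these cells and the integral of [G], which is the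
    same for all plans, are small ([step_majorant], [excess_small]). *)

(** * Cyclic monotonicity under permutations *)

Section cyclic_monotonicity.
Context {R : realType} {d : nat} {X : 'I_d -> ptopologicalType}.
Local Notation E := (prod_topology X).
Implicit Types (c : E -> R) (Gamma : set E).

(** Permuting each coordinate separately does not change the total of a sum of
    functions of one coordinate. *)
Lemma cyclically_monotone_set_subr c Gamma (g : forall i, X i -> R) :
  cyclically_monotone_set c Gamma ->
  cyclically_monotone_set (fun x => c x - \sum_(i < d) g i (x i)) Gamma.
Proof.
move=> cm n x sigma n1 xG s0; rewrite !sumrB; apply: lerB; first exact: cm.
rewrite exchange_big [leRHS]exchange_big /=; apply: ler_sum => i _.
by rewrite [leRHS](reindex_inj (@perm_inj _ (sigma i))).
Qed.

(** Relabelling the points by the inverse of the first permutation reduces to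
    the case in which the first coordinate is kept fixed. *)
Lemma cyclically_monotone_set_perm c Gamma n (x : 'I_n -> E)
    (sigma : 'I_d -> 'S_n) :
  (0 < d)%N -> cyclically_monotone_set c Gamma -> (forall k, Gamma (x k)) ->
  \sum_(k < n) c (x k) <= \sum_(k < n) c (fun i => x (sigma i k) i).
Proof.
move=> d0 cm xG; have [n1|] := leqP 1 n; last first.
  by rewrite ltnS leqn0 => /eqP n0; subst n; rewrite !big_ord0.
pose s0 := sigma (Ordinal d0).
rewrite [leRHS](reindex_inj (@perm_inj _ (s0^-1)%g)) /=.
have -> : \sum_(k < n) c (fun i => x (sigma i (s0^-1%g k)) i) =
    \sum_(k < n) c (fun i => x ((s0^-1 * sigma i)%g k) i).
  apply: eq_bigr => k _; congr c.
  by apply: functional_extensionality_dep => i; rewrite permM.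
apply: cm => // i i0; have -> : i = Ordinal d0 by exact: val_inj.
by rewrite mulVg.
Qed.

End cyclic_monotonicity.

(** * Rearrangement into prescribed cells *)

Lemma perm_prefix (L : eqType) (n : nat) (s : n.-tuple L) (t : seq L) :
  (forall l, count_mem l t <= count_mem l s)%N ->
  exists (p : 'S_n) (r : seq L), [tuple tnth s (p k) | k < n] = t ++ r :> seq L.
Proof.
move=> /count_subseqP[s1 ss1 ts1]; have [r ss1r] := perm_to_subseq ss1.
have /tuple_permP[p ep] : perm_eq (t ++ r) s.
  by rewrite perm_sym (permPl ss1r) perm_cat2r perm_sym.
by exists p, r.
Qed.

Definition replicate (A : finType) (f : A -> nat) : seq A :=
  flatten [seq nseq (f a) a | a <- enum A].

Lemma sum_replicate (R : nmodType) (A : finType) (f : A -> nat) (P : pred A)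
    (F : A -> R) :
  \sum_(a <- replicate f | P a) F a = \sum_(a | P a) F a *+ f a.
Proof.
rewrite big_flatten big_map big_enum /= [RHS]big_mkcond; apply: eq_bigr => a _.
rewrite big_mkcond big_nseq.
by elim: (f a) => [|n IH] /=; rewrite ?mulr0n ?if_same// IH; case: ifP;
  rewrite ?mulrS ?addr0.
Qed.

Lemma mem_replicate (A : finType) (f : A -> nat) a :
  (a \in replicate f) = (0 < f a)%N.
Proof.
apply/flattenP/idP => [[_ /mapP[b _ ->]]|fa].
  by rewrite mem_nseq => /andP[? /eqP ->].
exists (nseq (f a) a); rewrite ?mem_nseq ?fa ?eqxx//.
by apply: map_f; rewrite mem_enum.
Qed.

Lemma natr_count_replicate (R : nzSemiRingType) (A : finType) (f : A -> nat)
    (P : pred A) :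
  (count P (replicate f))%:R = \sum_(a | P a) (f a)%:R :> R.
Proof. by rewrite -sum1_count natr_sum sum_replicate. Qed.

Lemma ler0_natmul_bounded (R : archiRealFieldType) (x C : R) :
  (forall n : nat, n%:R * x <= C) -> x <= 0.
Proof.
move=> H; rewrite leNgt; apply/negP => x0.
have := H (Num.truncn (C / x)).+1; apply/negP; rewrite -ltNge -ltr_pdivrMr//.
exact: truncnS_gt.
Qed.

Section discrete.
Context {R : realType} {d : nat} {X : 'I_d -> ptopologicalType}.
Local Notation E := (prod_topology X).
Context {L : finType} (lab : forall i, X i -> L).
Local Notation cell := {ffun 'I_d -> L}.

Definition cell_of (x : E) : cell := [ffun i => lab (x i)].

(** One coordinate at a time, the labels demanded by the multiplicities [m] are
    available among the labels supplied by [f], so that permutations bring the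
    first [\sum_a m a] points into the prescribed cells.  Nothing is known about
    the cells of the remaining points, whose cost is bounded by the crude
    constant [\sum_a `|h a|]. *)
Lemma rearrangement (c : E -> R) (Gamma : set E) (h : cell -> R) (x : cell -> E)
    (f m : cell -> nat) :
  (0 < d)%N -> cyclically_monotone_set c Gamma ->
  (forall y, c y <= h (cell_of y)) ->
  (forall a, (0 < f a)%N -> Gamma (x a) /\ cell_of (x a) = a) ->
  (forall i l,
    (\sum_(a : cell | a i == l) m a <= \sum_(a : cell | a i == l) f a)%N) ->
  \sum_a c (x a) *+ f a <=
  \sum_a h a *+ m a + (\sum_a `|h a|) * (\sum_a (f a)%:R - \sum_a (m a)%:R).
Proof.
move=> d0 cm ch xa marg.
pose s := in_tuple (replicate f); pose t := replicate m.
pose N := size (replicate f); pose H := \sum_a `|h a|.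
have szE (g : cell -> nat) : (size (replicate g))%:R = \sum_a (g a)%:R :> R.
  by rewrite -natr_count_replicate count_predT.
have pre i : exists (p : 'S_N) (r : seq L),
    [tuple (tnth s (p k)) i | k < N] = [seq (a : cell) i | a <- t] ++ r :> seq L.
  have [|p [r e]] := @perm_prefix _ _ (map_tuple (fun a : cell => a i) s)
    [seq (a : cell) i | a <- t].
    move=> l; rewrite !count_map -(ler_nat R) !natr_count_replicate.
    by rewrite -!natr_sum ler_nat; exact: marg.
  exists p, r; rewrite -e; congr tval; apply: eq_from_tnth => k.
  by rewrite !tnth_mktuple tnth_map.
have [sigma pres] := choice pre.
have szt : (size t <= N)%N.
  have [r /(congr1 size)] := pres (Ordinal d0).
  by rewrite size_tuple size_cat size_map => ->; exact: leq_addr.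
pose y (k : 'I_N) : E := fun i => x (tnth s (sigma i k)) i.
have xs (k : 'I_N) : Gamma (x (tnth s k)) /\ cell_of (x (tnth s k)) = tnth s k.
  by apply: xa; rewrite -mem_replicate mem_tnth.
have yt (k : 'I_N) : (k < size t)%N -> cell_of (y k) = nth (tnth s k) t k.
  move=> kt; apply/ffunP => i; rewrite ffunE.
  have [r e] := pres i.
  have -> : lab (y k i) = tnth s (sigma i k) i.
    by have [_ /ffunP/(_ i)] := xs (sigma i k); rewrite ffunE.
  transitivity (nth (tnth s k i) [tuple (tnth s (sigma i k)) i | k < N] k).
    by rewrite nth_mktuple.
  by rewrite e nth_cat size_map kt (nth_map (tnth s k)).
have hH a : h a <= H.
  apply: le_trans (ler_norm _) _; rewrite /H (bigD1 a)//= lerDl.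
  by apply: sumr_ge0.
(* The bound for each rearranged point: the value of [h] on its prescribed
   cell, or [H] once the prescriptions are exhausted. *)
pose hs := [seq h a | a <- t] ++ nseq (N - size t) H.
have szhs : size hs = N by rewrite size_cat size_map size_nseq subnKC.
have := cyclically_monotone_set_perm sigma d0 cm (fun k => (xs k).1).
rewrite -(big_tuple _ _ _ predT (c \o x)) sum_replicate => /le_trans; apply.
apply: (@le_trans _ _ (\sum_(k < N) nth 0 hs k)).
  apply: ler_sum => k _; apply: le_trans (ch _) _.
  rewrite nth_cat size_map; case: ifPn => [kt|].
    by rewrite -/(y k) (yt k kt) (nth_map (tnth s k)).
  rewrite -leqNgt => kt; rewrite nth_nseq ifT// ltn_sub2r//.
  exact: leq_ltn_trans kt (ltn_ord k).
rewrite -(big_mkord predT) -[X in \sum_(0 <= i < X) _]szhs -(big_nth _ predT id).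
rewrite big_cat big_map big_nseq sum_replicate lerD2l -!szE -/N.
by rewrite iter_addr_0 -natrB // mulr_natr.
Qed.

(** The version of cyclic monotonicity with real weights.  The weights are
    multiplied by [n] and rounded to integers, [p] upwards and [q] downwards, so
    that the equality of the marginals becomes the inequality between counts
    that [rearrangement] asks for; the rounding errors are bounded
    independently of [n]. *)
Lemma cyclically_monotone_discrete (c : E -> R) (Gamma : set E)
    (h p q : cell -> R) (x : cell -> E) :
  (0 < d)%N -> cyclically_monotone_set c Gamma ->
  (forall y, c y <= h (cell_of y)) ->
  (forall a, 0 <= p a) -> (forall a, 0 <= q a) ->
  (forall a, 0 < p a -> Gamma (x a) /\ cell_of (x a) = a) ->
  (forall i l,
    \sum_(a : cell | a i == l) p a = \sum_(a : cell | a i == l) q a) ->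
  \sum_a p a * c (x a) <= \sum_a q a * h a.
Proof.
move=> d0 cm ch p0 q0 xa marg; rewrite -subr_le0.
have pq : \sum_a p a = \sum_a q a.
  pose i := Ordinal d0.
  rewrite (partition_big (fun a : cell => a i) predT)//=.
  rewrite [RHS](partition_big (fun a : cell => a i) predT)//=.
  by apply: eq_bigr => l _; exact: marg.
pose H := \sum_a `|h a|.
apply: (@ler0_natmul_bounded _ _
  (\sum_a `|c (x a)| + \sum_a `|h a| + H * \sum_(a : cell) 2)).
move=> n.
(* Where [p] vanishes the point [x a] may lie outside [Gamma], and the
   multiplicity has to be zero, not one. *)
pose f a := if p a == 0 then 0%N else (Num.truncn (n%:R * p a)).+1.
pose m a := Num.truncn (n%:R * q a).
have np a : 0 <= n%:R * p a by rewrite mulr_ge0.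
have nq a : 0 <= n%:R * q a by rewrite mulr_ge0.
have fP a : n%:R * p a <= (f a)%:R <= n%:R * p a + 1.
  rewrite /f; case: eqP => [->|_]; first by rewrite mulr0; apply/andP; split; lra.
  have /andP[lo up] := truncn_itv (np a).
  by rewrite (ltW up) -natr1 lerD2r.
have mP a : n%:R * q a - 1 <= (m a)%:R <= n%:R * q a.
  have /andP[lo up] := truncn_itv (nq a).
  by rewrite lo andbT lerBlDr natr1 ltW.
have fxa a : (0 < f a)%N -> Gamma (x a) /\ cell_of (x a) = a.
  by rewrite /f; case: eqP => // /eqP pa _; apply: xa; rewrite lt_def pa p0.
have marg' i l :
    (\sum_(a : cell | a i == l) m a <= \sum_(a : cell | a i == l) f a)%N.
  rewrite -(ler_nat R) !natr_sum.
  apply: (@le_trans _ _ (\sum_(a : cell | a i == l) n%:R * q a)).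
    by apply: ler_sum => a _; case/andP: (mP a).
  rewrite -mulr_sumr -marg mulr_sumr.
  by apply: ler_sum => a _; case/andP: (fP a).
have := rearrangement d0 cm ch fxa marg'; rewrite -/H.
have : n%:R * \sum_a p a * c (x a) <= \sum_a c (x a) *+ f a + \sum_a `|c (x a)|.
  rewrite mulr_sumr -big_split /=; apply: ler_sum => a _.
  rewrite -mulr_natr; have /andP[f1 f2] := fP a.
  have : 0 <= `|c (x a)| * (1 - ((f a)%:R - n%:R * p a)) by rewrite mulr_ge0//; lra.
  have : - `|c (x a)| * ((f a)%:R - n%:R * p a) <=
      c (x a) * ((f a)%:R - n%:R * p a).
    by rewrite ler_wpM2r// ?lerNnormlW//; lra.
  lra.
have : \sum_a h a *+ m a <= n%:R * \sum_a q a * h a + \sum_a `|h a|.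
  rewrite mulr_sumr -big_split /=; apply: ler_sum => a _.
  rewrite -mulr_natr; have /andP[m1 m2] := mP a.
  have : 0 <= `|h a| * (1 - (n%:R * q a - (m a)%:R)) by rewrite mulr_ge0//; lra.
  have : - `|h a| * (n%:R * q a - (m a)%:R) <= h a * (n%:R * q a - (m a)%:R).
    by rewrite ler_wpM2r// ?lerNnormlW//; lra.
  lra.
have : H * (\sum_a (f a)%:R - \sum_a (m a)%:R) <= H * \sum_(a : cell) 2.
  apply: ler_wpM2l; first exact: sumr_ge0.
  have : \sum_a (f a)%:R <= n%:R * \sum_a p a + \sum_(a : cell) 1.
    rewrite mulr_sumr -big_split /=; apply: ler_sum => a _.
    by case/andP: (fP a).
  have : n%:R * \sum_a q a <= \sum_a (m a)%:R + \sum_(a : cell) 1.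
    rewrite mulr_sumr -big_split /=; apply: ler_sum => a _.
    by rewrite -lerBlDr; case/andP: (mP a).
  have -> : \sum_(a : cell) (2 : R) = \sum_(a : cell) 1 + \sum_(a : cell) 1.
    by rewrite -big_split.
  rewrite pq; lra.
rewrite -/H mulrBr; lra.
Qed.

End discrete.

(** * Boxes in a product of Polish spaces *)

Section polish_borel.
Context {R : realType}.

Lemma polish_countable_basis (T : ptopologicalType) : polish R T ->
  exists V : nat -> set T, (forall n, open (V n)) /\
    forall (x : T) (A : set T), nbhs x A -> exists2 n, V n x & V n `<=` A.
Proof.
move=> [[D cD dD] [dist [[dxx _ dC dtri] dnbhs _]]].
pose b (y : T) (k : nat) := [set z | dist y z < k.+1%:R^-1].
have bo y k : open (b y k).
  rewrite openE => z; rewrite /b /= => yz; apply/dnbhs.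
  exists (k.+1%:R^-1 - dist y z); first by rewrite subr_gt0.
  move=> w /=; rewrite ltrBrDl; exact: le_lt_trans.
have /pcard_surjP[f Df] := cD.
have dense_b y k : exists n, b y k (f n).
  have [z [bz Dz]] : (b y k `&` D) !=set0.
    by apply: dD; [exists y; rewrite /b /= dxx invr_gt0|exact: bo].
  by have [n _ fn] := Df _ Dz; exists n; rewrite fn.
pose dec n := odflt (0, 0)%N (unpickle n).
exists (fun n => b (f (dec n).1) (dec n).2).
split=> [n|x A /dnbhs[e e0 eA]]; first exact: bo.
pose k := Num.truncn (2 / e).
have ke : 2 * k.+1%:R^-1 < e.
  have := truncnS_gt (2 / e); rewrite -/k => h.
  by rewrite ltr_pdivrMr// mulrC -ltr_pdivrMr.
have [n bn] := dense_b x k.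
exists (pickle (n, k)); rewrite /dec pickleK; first by rewrite /b /= dC.
move=> z /= fz; apply: eA => /=; apply: le_lt_trans (dtri (f n) _ _) _.
by apply: le_lt_trans ke; rewrite mulr_natl mulr2n; apply: lerD; exact: ltW.
Qed.

End polish_borel.

Section boxes.
Context {R : realType} {d : nat} {X : 'I_d -> ptopologicalType}.
Local Notation E := (prod_topology X).

Lemma measurable_proj i : measurable_fun setT (proj i : borel E -> borel (X i)).
Proof.
apply: (@measurability _ _ (borel E) (borel (X i)) setT _ (@open (X i))) => //.
move=> _ [U oU <-]; rewrite setTI; apply: sub_sigma_algebra.
have pc : continuous (proj i : E -> X i) by exact: proj_continuous.
exact: (continuousP _).1 pc U oU.
Qed.

Lemma continuous_measurable_cost (c : E -> R) : continuous c ->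
  measurable_fun setT (c : borel E -> R).
Proof.
move=> /continuousP cc.
apply: (measurability _ (RGenOpens.measurableE R)).
move=> _ [_ [a [b ->] <-]]; rewrite setTI.
by apply: sub_sigma_algebra; apply: cc; exact: interval_open.
Qed.

Definition box (A : forall i, set (X i)) : set E := [set x | forall i, A i (x i)].

Lemma measurable_box (A : forall i, set (borel (X i))) :
  (forall i, measurable (A i)) -> measurable (box A : set (borel E)).
Proof.
move=> mA; rewrite (_ : box A = \bigcap_(i in setT) (proj i @^-1` A i)); last first.
  by apply/seteqP; split=> [x xA i _|x xA i]; [exact: xA|exact: (xA i)].
apply: fin_bigcap_measurable; first exact: finite_finset.
move=> i _; rewrite -[X in measurable X]setTI; exact: measurable_proj.
Qed.

(** The sets that contain a box of neighbourhoods form a filter, and this filter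
    converges to [x] in each coordinate. *)
Lemma nbhs_box (x : E) (A : set E) : nbhs x A ->
  exists2 U : forall i, set (X i), (forall i, nbhs (x i) (U i)) & box U `<=` A.
Proof.
pose F : set_system E := [set A | exists2 U : forall i, set (X i),
   (forall i, nbhs (x i) (U i)) & box U `<=` A].
have FF : Filter F.
  split=> [|P Q [U xU UP] [V xV VQ]|P Q PQ [U xU UP]].
  - by exists (fun=> setT) => // i; exact: filterT.
  - exists (fun i => U i `&` V i) => [i|y yUV]; first exact: filterI.
    by split; [apply: UP|apply: VQ] => i; have [] := yUV i.
  - by exists U => //; exact: subset_trans PQ.
suff : F --> x by exact.
apply/cvg_sup => i B; rewrite nbhsE => -[_ [[W oW <-] Wx] WB].
exists (dfwith (fun j => setT) i W) => [j|y yW].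
  have [->|ji] := eqVneq j i; first by rewrite dfwithin; exact: open_nbhs_nbhs.
  by rewrite dfwithout 1?eq_sym//; exact: filterT.
by apply: WB; have := yW i; rewrite dfwithin.
Qed.

Lemma open_measurable_borel (T : ptopologicalType) (U : set T) :
  open U -> measurable (U : set (borel T)).
Proof. exact: sub_sigma_algebra. Qed.

(** The boxes with sides in countable bases that have a small oscillation of [c]
    are countably many and cover the space; continuity of the measure selects
    finitely many of them. *)
Lemma finite_box_cover (P : probability (borel E) R) (c : E -> R) (e delta : R) :
  (0 < d)%N -> (forall i, polish R (X i)) -> continuous c ->
  0 < e -> 0 < delta ->
  exists (n : nat) (U : 'I_n -> forall i, set (X i)),
  [/\ forall j i, open (U j i),
      forall j x y, box (U j) x -> box (U j) y -> c x <= c y + e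
    & (P (~` \bigcup_(j in setT) box (U j)) <= delta%:E)%E].
Proof.
move=> d0 pX cc e0 delta0.
pose V i := projT1 (cid (polish_countable_basis (pX i))).
have HV i := projT2 (cid (polish_countable_basis (pX i))).
rewrite -/(V _) in HV.
pose good (s : {ffun 'I_d -> nat}) := forall x y,
  box (fun i => V i (s i)) x -> box (fun i => V i (s i)) y -> c x <= c y + e.
(* Indices that encode no box of small oscillation get an empty box. *)
pose U n i : set (X i) := if (unpickle n : option {ffun 'I_d -> nat}) is Some s
  then (if `[< good s >] then V i (s i) else set0) else set0.
have oU n i : open (U n i).
  rewrite /U; case: unpickle => [s|]; last exact: open0.
  by case: ifP => _; [exact: (HV i).1|exact: open0].
have oscU n x y : box (U n) x -> box (U n) y -> c x <= c y + e.
  rewrite /U /box /=; case: unpickle => [s|xU]; last by have := xU (Ordinal d0).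
  by case: asboolP => [+ xU|_ xU]; [exact|have := xU (Ordinal d0)].
have coverU : \bigcup_n box (U n) = setT.
  apply/seteqP; split=> // x _.
  have : nbhs x [set y | `|c x - c y| < e / 2].
    by have /cvgrPdist_lt := cc x; apply; rewrite divr_gt0.
  move=> /nbhs_box[W xW Wc].
  have /choice[s sP] : forall i, exists n, V i n (x i) /\ V i n `<=` W i.
    by move=> i; have [n ? ?] := (HV i).2 _ _ (xW i); exists n.
  pose s' := [ffun i => s i].
  have s'W y : box (fun i => V i (s' i)) y -> `|c x - c y| < e / 2.
    by move=> sy; apply: Wc => i; apply: (sP i).2; have := sy i; rewrite ffunE.
  have gs : good s'.
    move=> y z /s'W + /s'W; rewrite !ltr_norml => /andP[? ?] /andP[? ?]; lra.
  exists (pickle s') => // i; rewrite /U pickleK ifT; last exact/asboolP.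
  by rewrite ffunE; exact: (sP i).1.
pose F n : set (borel E) := \big[setU/set0]_(j < n) box (U j).
have mF n : measurable (F n).
  apply: bigsetU_measurable => j _; apply: measurable_box => i.
  exact: open_measurable_borel.
have bigF : \bigcup_n F n = setT.
  rewrite -coverU; apply/seteqP; split=> x [n _]; first exact: bigsetU_bigcup.
  by move=> xn; exists n.+1 => //; rewrite /F big_ord_recr; right.
have ndF : nondecreasing_seq F.
  move=> m n mn; apply/subsetPset.
  exact: (@subset_bigsetU _ (fun j => box (U j))).
have : P \o F @ \oo --> 1%E.
  rewrite -(probability_setT P) -bigF.
  by apply: nondecreasing_cvg_mu => //; rewrite bigF.
move=> /fine_cvgP[_ /cvgrPdist_lt/(_ _ delta0)[n _ /(_ n (leqnn n))]] /= Pn.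
exists n, (fun j => U j); split=> // [j x y|]; first exact: oscU.
have -> : \bigcup_(j in [set: 'I_n]) box (U j) = F n.
  rewrite /F -(bigcup_mkord n (fun j => box (U j))).
  apply/seteqP; split=> x [j jn xj].
    by exists (val j) => //=.
  by exists (Ordinal jn).
rewrite probability_setC//.
rewrite -(fineK (fin_num_measure P _ (mF n))) -EFinB lee_fin.
by move: Pn; rewrite ltr_norml => /andP[_ /ltW].
Qed.

End boxes.

(** * Finite measurable partitions *)

Section finite_partition.
Context {disp : measure_display} {T : measurableType disp} {R : realType}.
Context (P : probability T R).

Lemma Rintegral_probability_cst (r : R) : \int[P]_x r = r.
Proof.
have PT : fine (P setT) = 1.
  by rewrite -[RHS]/(fine 1%E); congr fine; exact: probability_setT.
by rewrite Rintegral_cst// PT mulr1.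
Qed.

Lemma Rintegral_fibers (A : finType) (phi : T -> A) (f : T -> R) :
  (forall a, measurable (phi @^-1` [set a])) ->
  P.-integrable setT (EFin \o f) ->
  \int[P]_x f x = \sum_a \int[P]_(x in phi @^-1` [set a]) f x.
Proof.
move=> mphi intf; have [mf _] := integrableP _ _ _ intf.
have cover : \big[setU/set0]_(a <- enum A) (phi @^-1` [set a]) = setT.
  rewrite -subTset => x _; rewrite -bigcup_seq.
  by exists (phi x); rewrite //= mem_enum.
rewrite /Rintegral -[in LHS]cover integral_bigsetU_EFin //=.
- rewrite big_enum /= -sum_fine// => a _; apply: integrable_fin_num => //.
  by apply: integrableS intf.
- exact: enum_uniq.
- apply/trivIsetP => a b _ _ /eqP ab; apply/seteqP; split=> // x [/= xa xb].
  by case: ab; rewrite -xa.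
- by rewrite cover.
Qed.

Lemma measurable_fun_fibers (A : finType) (phi : T -> A) (h : A -> R) :
  (forall a, measurable (phi @^-1` [set a])) ->
  measurable_fun setT (h \o phi).
Proof.
move=> mphi _ B _; rewrite setTI.
rewrite (_ : _ @^-1` B = \bigcup_(a in [set a | B (h a)]) (phi @^-1` [set a])).
  by apply: fin_bigcup_measurable => //; exact: finite_finset.
by apply/seteqP; split=> [x Bx|x [a /= Ba xa]]; [exists (phi x)|rewrite /= xa].
Qed.

Lemma integrable_fibers (A : finType) (phi : T -> A) (h : A -> R) :
  (forall a, measurable (phi @^-1` [set a])) ->
  P.-integrable setT (EFin \o (h \o phi)).
Proof.
move=> mphi; apply: measurable_bounded_integrable => //.
- by rewrite -ge0_fin_numE// fin_num_measure.
- exact: measurable_fun_fibers.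
- exists (\sum_a `|h a|); split; first exact: num_real.
  move=> M HM x _ /=; apply: le_trans (ltW HM).
  by rewrite (bigD1 (phi x))//= lerDl sumr_ge0.
Qed.

Lemma Rintegral_step (A : finType) (phi : T -> A) (h : A -> R) :
  (forall a, measurable (phi @^-1` [set a])) ->
  \int[P]_x h (phi x) = \sum_a fine (P (phi @^-1` [set a])) * h a.
Proof.
move=> mphi; rewrite (@Rintegral_fibers _ phi)//; last exact: integrable_fibers.
apply: eq_bigr => a _; rewrite mulrC -Rintegral_cst//.
by apply: eq_Rintegral => x; rewrite inE => <-.
Qed.

(** If [f] were below its average on [D] outside a null set, the integral of the
    difference, a positive function, would vanish. *)
Lemma exists_ge_average (D N : set T) (f : T -> R) :
  measurable D -> P.-negligible N -> P.-integrable D (EFin \o f) ->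
  (0 < P D)%E ->
  exists x, [/\ D x, ~ N x & \int[P]_(x in D) f x <= fine (P D) * f x].
Proof.
move=> mD [N' [mN' PN' NN']] intf PD; apply/not_existsP => H.
pose p := fine (P D); pose I := \int[P]_(x in D) f x.
pose g x := I - p * f x.
have fl x : (D `\` N') x -> 0 < g x.
  move=> [Dx N'x]; rewrite subr_gt0 ltNge; apply/negP => pI.
  by apply: (H x); split => // /NN'.
have mDN : measurable (D `\` N') by exact: measurableD.
have intpf : P.-integrable D (EFin \o (fun x => p * f x)).
  exact: (integrableZl mD p intf).
have intI : P.-integrable D (EFin \o cst I).
  exact: finite_measure_integrable_cst.
have intg : P.-integrable D (EFin \o g) by exact: (integrableB mD intI intpf).
have g0 : (\int[P]_(x in D `\` N') (g x)%:E = 0)%E.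
  rewrite -negligible_integral//.
  rewrite -[LHS]fineK ?integrable_fin_num// -/(Rintegral _ _ _) /g RintegralB//.
  by rewrite Rintegral_cst// RintegralZl// mulrC subrr.
have : P.-negligible (D `\` N').
  have mg : measurable_fun (D `\` N') (EFin \o g).
    have /integrableP[+ _] := intg.
    by apply: measurable_funS => //; exact: subDsetl.
  have /(ae_eq_integral_abs P mDN mg)[M [mM PM DM]] :
      (\int[P]_(x in D `\` N') `|(EFin \o g) x| = 0)%E.
    rewrite -g0; apply: eq_integral => x; rewrite inE => /fl gx.
    by rewrite /= gtr0_norm.
  exists M; split=> // x Dx; apply: DM => /= /(_ Dx)[gx0].
  by have := fl x Dx; rewrite gx0 ltxx.
move=> [M [mM PM DM]].
move: PD; apply/negP; rewrite -leNgt.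
apply: (@le_trans _ _ (P (M `|` N'))).
  apply: le_measure; rewrite ?inE//; first exact: measurableU.
  move=> x Dx; have [xN|xN] := pselect (N' x); first by right.
  by left; apply: DM.
have PMN : (P (M `|` N') <= P M + P N')%E by exact: measureU2.
by move: PMN; rewrite [P M]PM [P N']PN' adde0.
Qed.

End finite_partition.

(** * Comparison of two plans through a step function *)

Section step_bound.
Context {R : realType} {d : nat} {X : 'I_d -> ptopologicalType}.
Local Notation E := (prod_topology X).
Context {L : finType} (lab : forall i, X i -> L).
Local Notation cell := {ffun 'I_d -> L}.
Context (mlab : forall i l,
  measurable (@lab i @^-1` [set l] : set (borel (X i)))).

Lemma measurable_cell (a : cell) :
  measurable (cell_of (@lab) @^-1` [set a] : set (borel E)).
Proof.
rewrite (_ : _ @^-1` _ = box (fun i => @lab i @^-1` [set a i])).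
  by apply: measurable_box => i; exact: mlab.
apply/seteqP; split=> x /= => [<- i|xa]; first by rewrite /= ffunE.
by apply/ffunP => i; rewrite ffunE; exact: xa.
Qed.

(** Both sides integrate the indicator of the label [l] in coordinate [i], once
    over the cells and once over the pieces of [X i]. *)
Lemma sum_cells_proj (P : probability (borel E) R) i l :
  \sum_(a : cell | a i == l) fine (P (cell_of (@lab) @^-1` [set a])) =
  fine (P (proj i @^-1` (@lab i @^-1` [set l]))).
Proof.
have mi l' : measurable ((@lab i \o proj i) @^-1` [set l'] : set (borel E)).
  rewrite comp_preimage -[X in measurable X]setTI.
  by apply: measurable_proj => //; exact: mlab.
transitivity (\int[P]_x ((cell_of (@lab) x i == l)%:R : R)).
  rewrite (Rintegral_step P (fun a : cell => (a i == l)%:R) measurable_cell).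
  rewrite [LHS]big_mkcond; apply: eq_bigr => a _.
  by case: eqP; rewrite ?mulr1 ?mulr0.
transitivity (\int[P]_x (((@lab i \o proj i) x == l)%:R : R)).
  by apply: eq_Rintegral => x _; rewrite ffunE.
rewrite (Rintegral_step P (fun l' : L => (l' == l)%:R) mi) (bigD1 l)//= eqxx mulr1.
by rewrite big1 ?addr0// => l' /negbTE ->; rewrite mulr0.
Qed.

(** The cells are weighted by [mu] and [nu], which gives equal marginals, and each
    cell is represented by a point of [Gamma] whose cost is at least the
    average over the cell. *)
Lemma cyclically_monotone_step (mu nu : probability (borel E) R) (c : E -> R)
    (Gamma : set E) (h : cell -> R) :
  (0 < d)%N ->
  (forall i (A : set (borel (X i))), measurable A ->
     mu (proj i @^-1` A) = nu (proj i @^-1` A)) ->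
  cyclically_monotone_set c Gamma -> mu.-negligible (~` Gamma) ->
  mu.-integrable setT (EFin \o c) ->
  (forall x, c x <= h (cell_of (@lab) x)) ->
  \int[mu]_x c x <= \int[nu]_x h (cell_of (@lab) x).
Proof.
move=> d0 marg cm muG intc ch.
pose Q a : set (borel E) := cell_of (@lab) @^-1` [set a].
have mQ a : measurable (Q a) by exact: measurable_cell.
have intQ a : mu.-integrable (Q a) (EFin \o c) by exact: integrableS intc.
have : forall a, exists x : E,
    (0 < fine (mu (Q a)) -> Gamma x /\ cell_of (@lab) x = a) /\
    \int[mu]_(x in Q a) c x <= fine (mu (Q a)) * c x.
  move=> a; have [Qa|Qa] := ltP 0 (fine (mu (Q a))).
    have muQ : (0 < mu (Q a))%E.
      by rewrite -(fineK (fin_num_measure mu _ (mQ a))) lte_fin.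
    have [x [Qx Gx le_c]] := exists_ge_average (mQ a) muG (intQ a) muQ.
    by exists x; split=> // _; split=> //; exact: contrapT.
  (* A null cell need not meet [Gamma], but it contributes nothing. *)
  have mu0 : mu (Q a) = 0%E.
    apply/eqP; rewrite eq_le measure_ge0 andbT.
    by rewrite -(fineK (fin_num_measure mu _ (mQ a))) lee_fin.
  exists point; split=> //.
  by rewrite /Rintegral null_set_integral ?mu0 ?mul0r//; case/integrableP: (intQ a).
move=> /choice[x xP].
rewrite (Rintegral_fibers measurable_cell intc).
rewrite (Rintegral_step nu h measurable_cell).
apply: le_trans (ler_sum _ (fun a _ => (xP a).2)) _.
apply: (cyclically_monotone_discrete d0 cm ch).
- by move=> a; rewrite fine_ge0.
- by move=> a; rewrite fine_ge0.
- by move=> a /(xP a).1.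
- by move=> i l; rewrite !sum_cells_proj marg.
Qed.

End step_bound.

(** * Truncation of integrable functions *)

Definition excess {T : Type} {R : realType} (f : T -> R) (M : R) (x : T) : R :=
  Num.max (`|f x| - M) 0.

Section excess.
Context {disp : measure_display} {T : measurableType disp} {R : realType}.
Context (P : probability T R).

Lemma measurable_excess (f : T -> R) M :
  measurable_fun setT f -> measurable_fun setT (excess f M).
Proof.
move=> mf; apply: measurable_maxr => //; apply: measurable_funB => //.
exact: measurableT_comp.
Qed.

Lemma integrable_excess (f : T -> R) M : 0 <= M ->
  P.-integrable setT (EFin \o f) -> P.-integrable setT (EFin \o excess f M).
Proof.
move=> M0 intf; have mf : measurable_fun setT f.
  by apply/measurable_EFinP; case/integrableP: intf.
apply: le_integrable intf => //.
  by apply/measurable_EFinP; exact: measurable_excess.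
move=> x _; rewrite /= lee_fin /excess ger0_norm ?le_max ?lexx ?orbT//.
by rewrite ge_max normr_ge0 andbT lerBlDr lerDl.
Qed.

Lemma excess_small (f : T -> R) (e : R) :
  P.-integrable setT (EFin \o f) -> 0 < e ->
  exists2 M, 0 <= M & \int[P]_x excess f M x <= e.
Proof.
move=> intf e0; have mf : measurable_fun setT f.
  by apply/measurable_EFinP; case/integrableP: intf.
have [] := @dominated_convergence _ _ _ P setT measurableT
  (fun n => EFin \o excess f n%:R) (cst 0%E) (abse \o (EFin \o f)).
- by move=> n; apply/measurable_EFinP; exact: measurable_excess.
- exact: measurable_cst.
- apply: aeW => x _; apply: cvg_near_cst.
  exists (Num.truncn `|f x|).+1 => // n /= nx.
  rewrite /excess max_r// subr_le0; apply: ltW.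
  by apply: lt_le_trans (truncnS_gt _) _; rewrite ler_nat.
- exact: integrable_abse.
- apply: aeW => x n _; rewrite /= lee_fin /excess ger0_norm ?le_max ?lexx ?orbT//.
  by rewrite ge_max normr_ge0 andbT lerBlDr lerDl.
move=> _ _; rewrite integral0 => /fine_cvgP[_ /cvgrPdist_lt/(_ _ e0)].
move=> [n _ /(_ n (leqnn n))] /=; rewrite sub0r normrN => /ltW h.
by exists n%:R => //; apply: le_trans (ler_norm _) h.
Qed.

End excess.

(** * Integrals of functions of one coordinate *)

Section plans.
Context {R : realType} {d : nat} {X : 'I_d -> ptopologicalType}.
Local Notation E := (prod_topology X).
Context (mu_ : forall i, probability (borel (X i)) R)
  (P : probability (borel E) R) (PP : transport_plans mu_ P).

Lemma ge0_integral_plan i (g : borel (X i) -> \bar R) :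
  measurable_fun setT g -> (forall x, 0 <= g x)%E ->
  (\int[P]_x g (x i) = \int[mu_ i]_y g y)%E.
Proof.
move=> mg g0.
transitivity (\int[pushforward P (proj i : borel E -> borel (X i))]_y g y)%E.
  rewrite (ge0_integral_pushforward (@measurable_proj _ X i))//.
apply: eq_measure_integral => [|? A mA _]; first exact: measurable_proj.
exact: PP.
Qed.

Lemma integrable_plan i (f : X i -> R) :
  (mu_ i).-integrable setT (EFin \o f : borel (X i) -> _) ->
  P.-integrable setT (EFin \o (fun x : E => f (x i))).
Proof.
move=> /integrableP[mf intf]; apply/integrableP; split.
  by apply: (measurableT_comp mf); exact: measurable_proj.
rewrite (@ge0_integral_plan i (fun y => `|(f y)%:E|%E))//.
exact: measurableT_comp.
Qed.

Lemma ge0_Rintegral_plan i (g : X i -> R) :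
  measurable_fun setT (g : borel (X i) -> R) -> (forall x, 0 <= g x) ->
  \int[P]_x g (x i) = \int[mu_ i]_y g y.
Proof.
move=> mg g0; congr fine; apply: (@ge0_integral_plan i (EFin \o g)).
  exact/measurable_EFinP.
by move=> x; rewrite lee_fin.
Qed.

End plans.

(** * Approximation of the cost by step functions *)

Section majorant.
Context {R : realType} {d : nat} {X : 'I_d -> ptopologicalType}.
Local Notation E := (prod_topology X).

(** The pieces of [X i] are the atoms generated by the sides of finitely many
    boxes, so that a cell lies in a box as soon as it meets it.  The cells that
    meet no box have small mass, small enough to absorb the constant [M]. *)
Lemma step_majorant (nu : probability (borel E) R) (c G : E -> R) (M e : R) :
  (0 < d)%N -> (forall i, polish R (X i)) -> continuous c ->
  (forall x, 0 <= c x) -> nu.-integrable setT (EFin \o c) ->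
  0 <= M -> (forall x, 0 <= G x) -> (forall x, c x <= M + G x) -> 0 < e ->
  exists (L : finType) (lab : forall i, X i -> L) (h : {ffun 'I_d -> L} -> R),
  [/\ forall i l, measurable (@lab i @^-1` [set l] : set (borel (X i))),
      forall x, c x - G x <= h (cell_of lab x)
    & \int[nu]_x h (cell_of lab x) <= \int[nu]_x c x + e].
Proof.
move=> d0 pX cc c0 intc M0 G0 cMG e0.
pose e3 := e / 3; have e30 : 0 < e3 by rewrite divr_gt0.
have M1 : 0 < M + 1 by lra.
have [n [U [oU oscU nuU]]] :=
  finite_box_cover nu d0 pX cc e30 (divr_gt0 e30 M1).
pose lab i (y : X i) : {ffun 'I_n -> bool} := [ffun j => `[< U j i y >]].
pose good (a : {ffun 'I_d -> {ffun 'I_n -> bool}}) := [exists j, [forall i, a i j]].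
pose bad : set (borel E) := ~` \bigcup_(j in setT) box (U j).
have goodP (x : E) j : [forall i, cell_of lab x i j] <-> box (U j) x.
  split=> [/forallP Ux i|Ux]; first by have := Ux i; rewrite !ffunE => /asboolP.
  by apply/forallP => i; rewrite !ffunE; apply/asboolP; exact: Ux.
have badP (x : E) : ~~ good (cell_of lab x) -> bad x.
  by move=> + [j _ xj] => /existsPn/(_ j)/negP; apply; apply/goodP.
pose z a : E := xget point [set x | cell_of lab x = a].
have zP (x : E) : cell_of lab (z (cell_of lab x)) = cell_of lab x.
  have : exists y, [set y : E | cell_of lab y = cell_of lab x] y by exists x.
  by move=> /(xgetPex point).
pose h a := if good a then c (z a) + e3 else M.
have goodle (x y : E) : cell_of lab x = cell_of lab y ->
    good (cell_of lab x) -> c x <= c y + e3.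
  move=> xy /existsP[j jx]; apply: (oscU j); apply/goodP => //.
  by rewrite -xy.
have mlab i l : measurable (@lab i @^-1` [set l] : set (borel (X i))).
  pose V j : set (borel (X i)) := if l j then U j i else ~` U j i.
  rewrite (_ : _ @^-1` _ = \bigcap_(j in setT) V j).
    apply: fin_bigcap_measurable => [|j _]; first exact: finite_finset.
    have mU := open_measurable_borel (oU j i).
    by rewrite /V; case: (l j) => //; exact: measurableC.
  apply/seteqP; split=> [y /= yl j _|y yV].
    by rewrite /V -yl /lab ffunE; case: asboolP.
  apply/ffunP => j; rewrite ffunE; have := yV j I; rewrite /V.
  by case: (l j) => ?; [exact/asboolP|exact/asboolPn].
have mbad : measurable bad.
  apply: measurableC; apply: fin_bigcup_measurable => [|j _].
    exact: finite_finset.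
  by apply: measurable_box => i; exact: open_measurable_borel.
exists {ffun 'I_n -> bool}, lab, h; split=> // [x|].
  rewrite /h; case: ifPn => [gx|_]; last by rewrite lerBlDr.
  have := goodle x (z (cell_of lab x)) (esym (zP x)) gx.
  by have := G0 x; lra.
have hle (x : E) : h (cell_of lab x) <= (c x + 2 * e3) + M * \1_bad x.
  rewrite /h; case: ifPn => [gx|/badP bx].
    have := goodle (z (cell_of lab x)) x (zP x).
    have : 0 <= M * \1_bad x by rewrite mulr_ge0.
    by rewrite zP => ? /(_ gx); lra.
  by rewrite indicE mem_set// mulr1; have := c0 x; lra.
have intce : nu.-integrable setT (EFin \o (fun x : borel E => c x + 2 * e3)).
  exact: (integrableD measurableT intc
    (finite_measure_integrable_cst nu (2 * e3) measurableT)).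
have int1 : nu.-integrable setT (EFin \o (\1_bad : borel E -> R)).
  exact: integrable_indic.
have intM1 : nu.-integrable setT (EFin \o (fun x : borel E => M * \1_bad x)).
  exact: (integrableZl measurableT M int1).
have inth : nu.-integrable setT (EFin \o (h \o cell_of lab)).
  by apply: integrable_fibers; exact: measurable_cell.
apply: le_trans (le_Rintegral measurableT inth _ (fun x _ => hle x)) _.
  exact: (integrableD measurableT intce intM1).
rewrite RintegralD// RintegralD//; last exact: finite_measure_integrable_cst.
rewrite (Rintegral_probability_cst nu) RintegralZl//.
have -> : \int[nu]_x \1_bad x = fine (nu bad).
  by rewrite /Rintegral integral_indic// setIT.
have nub : fine (nu bad) <= e3 / (M + 1).
  by rewrite -lee_fin fineK// fin_num_measure.
have : M * fine (nu bad) <= e3.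
  apply: le_trans (ler_wpM2l M0 nub) _.
  by rewrite mulrCA ler_piMr// ?(ltW e30)// ler_pdivrMr// mul1r; lra.
have -> : e = 3 * e3 by rewrite /e3 mulrC divfK.
lra.
Qed.

End majorant.

(** * Optimality *)

Section optimality.
Context {R : realType} {d : nat} {X : 'I_d -> ptopologicalType}.
Local Notation E := (prod_topology X).

(** The sum [G] of the excesses of the [f i] over thresholds [M i] has a small
    integral for [mu]; the comparison through a step function is applied to
    [c - G]. *)
Lemma cyclically_monotone_le_plan (mu_ : forall i, probability (borel (X i)) R)
    (c : E -> R) (f : forall i, X i -> R) (mu nu : probability (borel E) R) :
  (0 < d)%N -> (forall i, polish R (X i)) -> continuous c ->
  (forall x, 0 <= c x) ->
  (forall i, (mu_ i).-integrable [set: borel (X i)] (EFin \o f i)) ->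
  (forall x, c x <= \sum_(i < d) f i (x i)) ->
  transport_plans mu_ mu -> transport_plans mu_ nu ->
  cyclically_monotone_plan c mu ->
  (transport_cost c mu <= transport_cost c nu)%E.
Proof.
move=> d0 pX cc c0 intf cf mu_plan nu_plan [Gamma cm muG].
have intc P : transport_plans mu_ P ->
    P.-integrable setT (EFin \o c : borel E -> _).
  move=> PP; have intF : P.-integrable setT
      (fun x : borel E => \sum_(i < d) (f i (x i))%:E)%E.
    by apply: integrable_sum => // i _; exact: (integrable_plan PP).
  apply: le_integrable intF => //.
    by apply/measurable_EFinP; exact: continuous_measurable_cost.
  move=> x _; rewrite sumEFin /= lee_fin ger0_norm//.
  by apply: le_trans (cf x) (ler_norm _).
have intc_mu := intc _ mu_plan; have intc_nu := intc _ nu_plan.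
rewrite /transport_cost -[leLHS]fineK ?integrable_fin_num//.
rewrite -[leRHS]fineK ?integrable_fin_num// lee_fin.
rewrite -/(Rintegral mu setT c) -/(Rintegral nu setT c).
apply/ler_addgt0Pr => e e0.
have de0 : 0 < e / 2 / d%:R by rewrite !divr_gt0// ltr0n.
have /choice[M M0e] : forall i, exists m, 0 <= m /\
    \int[mu_ i]_x excess (f i) m x <= e / 2 / d%:R.
  by move=> i; have [m m0 me] := excess_small (intf i) de0; exists m.
have M0 i : 0 <= M i := (M0e i).1.
pose g i (x : E) := excess (f i) (M i) (x i).
have intg i : mu.-integrable setT (EFin \o g i).
  exact/(integrable_plan mu_plan)/integrable_excess.
have gi i : \int[mu]_x g i x = \int[mu_ i]_y excess (f i) (M i) y.
  apply: (ge0_Rintegral_plan mu_plan).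
    by apply: measurable_excess; apply/measurable_EFinP; case/integrableP: (intf i).
  by move=> y; rewrite le_max lexx orbT.
pose G (x : E) := \sum_(i < d) g i x.
have intG : mu.-integrable setT (EFin \o G : borel E -> _).
  rewrite (_ : _ \o _ = (fun x : borel E => \sum_(i < d) (EFin \o g i) x)%E).
    exact: integrable_sum.
  by apply/funext => x; rewrite /= sumEFin.
have Ge : \int[mu]_x G x <= e / 2.
  rewrite /Rintegral /G.
  under eq_integral do rewrite -sumEFin.
  rewrite integral_sum// -sum_fine => [|i _]; last first.
    exact: (integrable_fin_num measurableT (intg i)).
  apply: (@le_trans _ _ (\sum_(i < d) e / 2 / d%:R)).
    by apply: ler_sum => i _; have := (M0e i).2; rewrite -gi.
  by rewrite sumr_const card_ord -[_ *+ d]mulr_natr divfK// pnatr_eq0 -lt0n.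
have G0 x : 0 <= G x by apply: sumr_ge0 => i _; rewrite le_max lexx orbT.
have cMG x : c x <= \sum_i M i + G x.
  apply: le_trans (cf x) _; rewrite -big_split /=; apply: ler_sum => i _.
  rewrite /excess -lerBlDl le_max; apply/orP; left.
  by rewrite lerD2r ler_norm.
have [L [lab [h [mlab hc hnu]]]] := step_majorant d0 pX cc c0 intc_nu
  (sumr_ge0 _ (fun i _ => M0 i)) G0 cMG (divr_gt0 e0 (ltr0Sn _ 1)).
have marg i (A : set (borel (X i))) : measurable A ->
    mu (proj i @^-1` A) = nu (proj i @^-1` A).
  by move=> mA; have := mu_plan i A mA; rewrite -(nu_plan i A mA).
have := cyclically_monotone_step mlab d0 marg
  (cyclically_monotone_set_subr (fun i => excess (f i) (M i)) cm) muG
  (integrableB measurableT intc_mu intG) hc.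
rewrite RintegralB// => step.
by move: step hnu Ge; lra.
Qed.

End optimality.

Theorem theorem1p2 (R : realType) (d : nat) (hd : (2 <= d)%N)
    (X : 'I_d -> ptopologicalType) (hX : forall i, polish R (X i))
    (mu_ : forall i, probability (borel (X i)) R)
    (c : prod_topology X -> R) (hc0 : forall x, 0 <= c x)
    (hc : continuous c)
    (hcf : exists f : forall i, X i -> R,
      (forall i, (mu_ i).-integrable [set: borel (X i)] (EFin \o f i)) /\
      (forall x, c x <= \sum_(i < d) f i (x i)))
    (mu : probability (borel (prod_topology X)) R)
    (hmu : transport_plans mu_ mu)
    (hcm : cyclically_monotone_plan c mu) :
  optimal c mu_ mu.
Proof.
have [f [intf cf]] := hcf.
apply/eqP; rewrite eq_le; apply/andP; split.
  apply: le_ereal_inf_tmp => _ [nu nu_plan <-].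
  exact: (cyclically_monotone_le_plan (ltnW hd) hX hc hc0 intf cf hmu nu_plan hcm).
by apply: ereal_inf_lbound; exists mu.
Qed.
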